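(* Let $A$ be a positive information algebra, let $L$ be a (possibly empty) well-ordered set disjoint from $A$, and let $S=A\uplus_{\mathrm{ord}}L$ be the overflow semiring. Then the Krull dimension of $S$ is given by \[ \dim S=\begin{cases}\dim A, & \text{if } L=\varnothing\text{ and }\dim A<\infty,\\ \infty, & \text{if } L\text{ is infinite or }\dim A=\infty,\\ |L|+\dim A, & \text{if } L\text{ is finite and nonempty and }\dim A<\infty.\end{cases} \]
   Context: All semirings are commutative: $(S,+,0)$ and $(S,\cdot,1)$ are commutative monoids, $1\neq 0$, multiplication distributes over addition, and $0$ is absorbing. A semiring is zerosumfree if $a+b=0$ implies $a=b=0$, and entire if $ab=0$ implies $a=0$ or $b=0$; an information algebra is a zerosumfree entire semiring. A positive information algebra is an information algebra with a partial order $\leq$ compatible with $+$ and $\cdot$ (i.e. $x\leq y$ implies $x+z\leq y+z$ and $xz\leq yz$) and having $0$ as least element. An ideal of a semiring $S$ is a nonempty subset $I$ with $a+b\in I$ and $sa\in I$ for all $a,b\in I$, $s\in S$. A proper ideal $P$ is prime if $ab\in P$ implies $a\in P$ or $b\in P$. The Krull dimension $\dim S$ is the supremum of all integers $n\geq 0$ such that there is a strictly ascending chain $P_0\subset P_1\subset\cdots\subset P_n$ of prime ideals of $S$ ($\infty$ if there is no finite supremum). Overflow semiring $S=A\uplus_{\mathrm{ord}}L$: $S=A\cup L$ with the order extending those of $A$ and $L$ by $a\leq\ell$ for all $a\in A,\ell\in L$ (and never $\ell\leq a$), and operations: $x+y=x+_Ay$ if $x,y\in A$, $x+y=\sup\{x,y\}$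 otherwise; $xy=x\cdot_Ay$ if $x,y\in A\setminus\{0\}$, $xy=0$ if $x=0$ or $y=0$, and $xy=\sup\{x,y\}$ otherwise. With these, $S$ is a positive information algebra (and $S=A$ if $L=\varnothing$). *)

(* Defs.v *)
From HB Require Import structures.
From mathcomp Require Import all_boot all_order all_algebra finmap.
From mathcomp Require Import all_classical constructive_ereal.

Set Implicit Arguments.
Unset Strict Implicit.
Unset Printing Implicit Defensive.

Import Order.TTheory GRing.Theory.

Local Open Scope classical_set_scope.
Local Open Scope ring_scope.

HB.mixin Record ComNzSemiRing_isInfoAlgebra A & GRing.ComNzSemiRing A := {
  zerosumfree : forall a b : A, a + b = 0 -> a = 0 /\ b = 0;
  entire : forall a b : A, a * b = 0 -> a = 0 \/ b = 0
}.

#[short(type="infoAlgType")]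
HB.structure Definition InfoAlgebra :=
  {A of ComNzSemiRing_isInfoAlgebra A & GRing.ComNzSemiRing A}.

(* The order is a field of the structure rather than an [Order.POrder] instance:
   Hierarchy-Builder rejects the join of [Order.POrder] with a semiring that is
   not a Z-module, as it would compete with [Num.POrderedZmodule]. *)
HB.mixin Record InfoAlgebra_isPositive A & InfoAlgebra A := {
  ple : rel A;
  ple_refl : reflexive ple;
  ple_anti : antisymmetric ple;
  ple_trans : transitive ple;
  ple_addr : forall x y z : A, ple x y -> ple (x + z) (y + z);
  ple_mulr : forall x y z : A, ple x y -> ple (x * z) (y * z);
  ple0 : forall x : A, ple 0 x
}.

#[short(type="posInfoAlgType")]
HB.structure Definition PosInfoAlgebra :=
  {A of InfoAlgebra_isPositive A & InfoAlgebra A}.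

Section KrullDimension.
Variable S : comNzSemiRingType.
Implicit Types (I P : set S) (n : nat).

Definition is_ideal I : Prop :=
  [/\ I !=set0,
      forall a b, I a -> I b -> I (a + b) &
      forall s a, I a -> I (s * a)].

Definition is_prime_ideal P : Prop :=
  [/\ is_ideal P, P <> setT & forall a b, P (a * b) -> P a \/ P b].

Definition prime_chain n (P : nat -> set S) : Prop :=
  (forall i, (i <= n)%N -> is_prime_ideal (P i)) /\
  (forall i, (i < n)%N -> P i `<` P i.+1).

(* The supremum is taken in the integers extended by -oo and +oo, where every
   set of natural numbers has one; -oo is the supremum of the empty set. *)
Definition krull_dim : \bar int :=
  supremum -oo%E [set n%:Z%:E | n in [set n | exists P : nat -> set S, prime_chain n P]].

End KrullDimension.

(* The disjoint union is a tagged sum: [inl] embeds A and [inr] embeds L. *)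
Definition overflow (A L : Type) : Type := (A + L)%type.

Section Overflow.
Context (A : posInfoAlgType) (d : Order.disp_t) (L : orderType d).
Local Notation S := (overflow A L).
Implicit Types x y z : S.

HB.instance Definition _ := Choice.copy S (A + L)%type.

Definition ovf_le x y : bool :=
  match x, y with
  | inl a, inl b => ple a b
  | inr l, inr m => (l <= m)%O
  | inl _, inr _ => true
  | inr _, inl _ => false
  end.

Definition ovf_max x y : S := if ovf_le x y then y else x.

Definition ovf_zero : S := inl 0.
Definition ovf_one : S := inl 1.

(* [ovf_max] is only used on pairs with at least one component in L; such
   pairs are comparable, so it is their supremum (see [ovf_max_sup]). *)
Definition ovf_add x y : S :=
  match x, y with
  | inl a, inl b => inl (a + b)
  | _, _ => ovf_max x y
  end.

Definition ovf_mul x y : S :=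
  if (x == ovf_zero) || (y == ovf_zero) then ovf_zero else
  match x, y with
  | inl a, inl b => inl (a * b)
  | _, _ => ovf_max x y
  end.

Fact ovf_le_refl : reflexive ovf_le.
Proof. by case=> a /=; rewrite ?ple_refl. Qed.

Fact ovf_le_anti : antisymmetric ovf_le.
Proof. by case=> a [] b //=; [move/ple_anti->|move/le_anti->]. Qed.

Fact ovf_le_trans : transitive ovf_le.
Proof. by case=> a [] b [] c //=; [apply: ple_trans|apply: le_trans]. Qed.

Fact ovf_max_sup x y : ~~ (is_inl x && is_inl y) ->
  [/\ ovf_le x (ovf_max x y), ovf_le y (ovf_max x y) &
      forall z, ovf_le x z -> ovf_le y z -> ovf_le (ovf_max x y) z].
Proof.
move=> xyL; rewrite /ovf_max; case: ifPn => [xy|nxy]; first by rewrite ovf_le_refl.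
rewrite ovf_le_refl; split=> //.
by case: x y xyL nxy => a [] b //= _; rewrite -ltNge => /ltW.
Qed.

Let maxlr (a : A) (l : L) : ovf_max (inl a : S) (inr l : S) = inr l.
Proof. by []. Qed.

Let maxrl (a : A) (l : L) : ovf_max (inr l : S) (inl a : S) = inr l.
Proof. by []. Qed.

Let maxrr (l m : L) : ovf_max (inr l : S) (inr m : S) = inr (Order.max l m).
Proof. by rewrite /ovf_max /=; case: leP. Qed.

Let maxE := (maxlr, maxrl, maxrr).

Let inl_eq0 (a : A) : ((inl a : S) == ovf_zero) = (a == 0).
Proof. by []. Qed.

Let inr_eq0 (l : L) : ((inr l : S) == ovf_zero) = false.
Proof. by []. Qed.

Let mul_eq0 (a b : A) : (a * b == 0) = (a == 0) || (b == 0).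
Proof.
by apply/eqP/orP => [/entire[]->|[]/eqP->]; rewrite ?eqxx ?mul0r ?mulr0; auto.
Qed.

Let add_eq0 (a b : A) : (a + b == 0) = (a == 0) && (b == 0).
Proof.
by apply/eqP/andP => [/zerosumfree[-> ->]|[/eqP-> /eqP->]]; rewrite ?addr0.
Qed.

Let mulll (a b : A) : ovf_mul (inl a) (inl b) = inl (a * b).
Proof.
rewrite /ovf_mul !inl_eq0; case: eqVneq => [->|_]; first by rewrite mul0r.
by case: eqVneq => [->|_] //; rewrite mulr0.
Qed.

Let mullr (a : A) (l : L) :
  ovf_mul (inl a) (inr l) = if a == 0 then inl 0 else inr l.
Proof. by rewrite /ovf_mul inl_eq0 inr_eq0 orbF. Qed.

Let mulrl (a : A) (l : L) :
  ovf_mul (inr l) (inl a) = if a == 0 then inl 0 else inr l.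
Proof. by rewrite /ovf_mul inl_eq0 inr_eq0. Qed.

Let mulrr (l m : L) : ovf_mul (inr l) (inr m) = inr (Order.max l m).
Proof. by rewrite /ovf_mul !inr_eq0 maxE. Qed.

Let mulE := (mulll, mullr, mulrl, mulrr).

Fact ovf_addA : associative ovf_add.
Proof. by case=> a [] b [] c; rewrite /ovf_add ?maxE ?addrA ?maxA. Qed.

Fact ovf_addC : commutative ovf_add.
Proof.
case=> a [] b; rewrite /ovf_add ?maxE //; [by rewrite addrC|by rewrite maxC].
Qed.

Fact ovf_add0 : left_id ovf_zero ovf_add.
Proof. by case=> a; rewrite /ovf_add /= ?maxE ?add0r. Qed.

HB.instance Definition _ := Algebra.isNmodule.Build S
  ovf_addA ovf_addC ovf_add0.

Local Ltac split_eq0 := repeat match goal with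
  | H : (@eq_op _ ?u _) = false |- context [@eq_op _ ?u _] => rewrite !H
  | u : _ |- context [@eq_op _ ?u _] => case: (eqVneq u 0) => [?|/negPf ?]; first subst u
  | _ => progress rewrite ?eqxx ?mulE ?mul0r ?mulr0 ?mul_eq0 ?maxE /=
  end.

Fact ovf_mulA : associative ovf_mul.
Proof.
by case=> a [] b [] c; rewrite ?mulE ?mulrA ?maxA ?mul_eq0 //; split_eq0.
Qed.

Fact ovf_mulC : commutative ovf_mul.
Proof.
by case=> a [] b; rewrite !mulE // 1?mulrC 1?maxC.
Qed.

Fact ovf_mul1 : left_id ovf_one ovf_mul.
Proof. by case=> a; rewrite mulE ?mul1r // (negPf (oner_neq0 A)). Qed.

Fact ovf_mulDl : left_distributive ovf_mul ovf_add.
Proof.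
case=> a [] b [] c; rewrite /ovf_add ?mulE ?mulrDl ?maxE ?add_eq0 //; split_eq0.
all: rewrite ?addr0 ?maxxx //.
- by rewrite maxCA maxxx.
- by rewrite -maxA maxxx.
- by rewrite maxACA maxxx.
Qed.

Fact ovf_mul0 : left_zero ovf_zero ovf_mul.
Proof. by case=> a; rewrite /ovf_mul eqxx. Qed.

Fact ovf_one_neq0 : ovf_one != ovf_zero.
Proof. by rewrite inl_eq0 oner_neq0. Qed.

HB.instance Definition _ := GRing.Nmodule_isComNzSemiRing.Build S
  ovf_mulA ovf_mulC ovf_mul1 ovf_mulDl ovf_mul0 ovf_one_neq0.

Fact ovf_zerosumfree (x y : S) : x + y = 0 -> x = 0 /\ y = 0.
Proof.
rewrite /GRing.add /GRing.zero /= /ovf_add.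
by case: x y => a [] b //; rewrite ?maxE // => -[] /zerosumfree[-> ->].
Qed.

Fact ovf_entire (x y : S) : x * y = 0 -> x = 0 \/ y = 0.
Proof.
rewrite /GRing.mul /GRing.zero /=.
case: x y => a [] b; rewrite mulE //.
- by move=> [ab0]; have [->|->] := entire _ _ ab0; [left|right].
- by case: eqVneq => // -> _; left.
- by case: eqVneq => // -> _; right.
Qed.

HB.instance Definition _ := ComNzSemiRing_isInfoAlgebra.Build S
  ovf_zerosumfree ovf_entire.

Let ple_eq0 (a : A) : ple a 0 -> a = 0.
Proof. by move=> a0; apply: ple_anti; rewrite a0 ple0. Qed.

Fact ovf_le_add (x y z : S) : ovf_le x y -> ovf_le (x + z) (y + z).
Proof.
rewrite /GRing.add /= /ovf_add.
case: x y z => a [] b [] c; rewrite ?maxE //=.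
- exact: ple_addr.
- by rewrite le_max lexx orbT.
- by move=> ab; apply: le_max2.
Qed.

Fact ovf_le_mul (x y z : S) : ovf_le x y -> ovf_le (x * z) (y * z).
Proof.
rewrite /GRing.mul /=.
case: x y z => a [] b [] c; rewrite ?mulE //.
- exact: ple_mulr.
- case: eqVneq => [_|/negPf a0] /=; first by case: ifP => /=; rewrite ?ple0.
  by case: eqVneq => //= -> /ple_eq0 /eqP; rewrite a0.
- by case: eqVneq => //= ->; rewrite mulr0 ple0.
- by case: ifP => //= _ _; rewrite le_max lexx orbT.
- by case: ifP => //= _ _; rewrite ple_refl.
- by move=> ab; apply: le_max2.
Qed.

Fact ovf_le0 (x : S) : ovf_le 0 x.
Proof. by case: x => a //=; apply: ple0. Qed.

HB.instance Definition _ := InfoAlgebra_isPositive.Build S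
  ovf_le_refl ovf_le_anti ovf_le_trans ovf_le_add ovf_le_mul ovf_le0.

End Overflow.

(* Main.v *)
Require Import Defs.
From HB Require Import structures.
From mathcomp Require Import all_boot all_order all_algebra finmap.
From mathcomp Require Import all_classical constructive_ereal.
From mathcomp Require wochoice.

Import Order.TTheory GRing.Theory.

Local Open Scope classical_set_scope.
Local Open Scope ring_scope.

(** A prime ideal of [S] is either [0] together with an up-set of [L], or a prime
    ideal of [A] together with all of [L]. The former are totally ordered by
    inclusion, and those with a proper up-set lie strictly below all the latter,
    so a chain of length [m] in [A] extends downwards by one step per element
    of [L]. Conversely, each strict step of a chain in [S] enlarges its trace on
    [A], which is a prime ideal, or its trace on [L]; if [L] is finite, the latter
    happens at most [|L|] times. *)

(** [supremum] picks some element of [supremums]; antisymmetry leaves at most one, so any known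
    supremum is the chosen one. Nonemptiness rules out the default value [x0]. *)
Lemma supremum_unique d (T : porderType d) (x0 x : T) (E : set T) :
  E !=set0 -> supremums E x -> supremum x0 E = x.
Proof.
move=> /set0P E0 Ex; rewrite /supremum (negPf E0).
by case: xgetP => [y _ Ey|/(_ x)//]; apply: (is_subset1_supremums Ey Ex).
Qed.

(** * Chains of prime ideals and the dimension of a semiring *)

Section KrullDim.
Variable S : comNzSemiRingType.
Implicit Types (I P : set S) (Q : nat -> set S) (n m : nat).

Lemma ideal0 I : is_ideal I -> I 0.
Proof. by case=> -[a Ia] _ IM; rewrite -(mul0r a); apply: IM. Qed.

Lemma ideal_not1 I : is_ideal I -> I <> setT <-> ~ I 1.
Proof.
move=> [_ _ IM]; split=> [IT I1|I1 IT]; last by apply: I1; rewrite IT.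
by apply: IT; apply/seteqP; split=> // a _; rewrite -(mulr1 a); apply: IM.
Qed.

Lemma prime_chainW n m Q : (m <= n)%N -> prime_chain n Q -> prime_chain m Q.
Proof.
move=> mn [Qprime Qlt]; split=> i im; first exact/Qprime/(leq_trans im).
exact/Qlt/(leq_trans im).
Qed.

Lemma prime_chain_rcons n Q P : prime_chain n Q -> is_prime_ideal P ->
  Q n `<` P -> prime_chain n.+1 (fun i => if (i <= n)%N then Q i else P).
Proof.
move=> [Qprime Qlt] Pprime QP; split=> i.
  by case: ifP => [/Qprime|].
rewrite ltnS => le_in; rewrite le_in; case: ltngtP le_in => // [lt_in|->] _.
  exact: Qlt.
exact: QP.
Qed.

Lemma krull_dim_fin n :
  (exists Q, prime_chain n Q) -> (forall m Q, prime_chain m Q -> (m <= n)%N) ->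
  krull_dim S = n%:Z%:E.
Proof.
move=> Qn max_n; apply: supremum_unique; first by exists n%:Z%:E, n.
split=> [_ [m [Q Qm]] <-|y]; first by rewrite lee_fin lez_nat; apply: max_n Qm.
by apply; exists n.
Qed.

Lemma krull_dim_infty :
  (forall n, exists Q, prime_chain n Q) -> krull_dim S = +oo%E.
Proof.
move=> chains; apply: supremum_unique.
  by exists 0%:E, 0%N => //; apply: chains.
split=> [x _|y y_ub]; first exact: leey.
case: y y_ub => [z|//|] y_ub; last first.
  by have := y_ub _ (ex_intro2 _ _ 0%N (chains 0%N) erefl).
(* A finite bound [z] is refuted by a chain longer than its absolute value. *)
have := y_ub _ (ex_intro2 _ _ `|z|.+1 (chains _) erefl).
by rewrite lee_fin => /le_trans /(_ (lez_abs z)); rewrite lez_nat ltnn.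
Qed.

End KrullDim.

(** * Dimension of an information algebra *)

Section InfoAlgebraKrullDim.
Variable A : infoAlgType.
Implicit Types (Q : nat -> set A).

(** Primality is entireness. This ideal gives a chain of length 0, and it is the trace on [A] of the
    lowest primes of the overflow semiring. *)
Lemma prime_ideal0 : is_prime_ideal ([set 0] : set A).
Proof.
have ideal_0 : is_ideal ([set 0] : set A).
  split=> [|a b -> ->|s a ->]; first by exists 0.
    by rewrite /= addr0.
  by rewrite /= mulr0.
split=> // [|a b /entire//].
by apply/(ideal_not1 _ _ ideal_0) => /eqP; rewrite oner_eq0.
Qed.

Lemma prime_chain0 : exists Q, prime_chain 0 Q.
Proof. by exists (fun=> [set 0]); split=> // i _; apply: prime_ideal0. Qed.

(** Chains can be truncated, so their lengths are closed downwards: either all lengths occur, or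
    they are bounded and, 0 being one of them, have a maximum. *)
Lemma krull_dimP :
  (exists2 n, krull_dim A = n%:Z%:E &
    (exists Q, prime_chain n Q) /\
    forall m Q, prime_chain m Q -> (m <= n)%N) \/
  krull_dim A = +oo%E /\ forall n, exists Q, prime_chain n Q.
Proof.
have [chains|/existsNP[N noN]] := pselect (forall n, exists Q, prime_chain n Q).
  by right; split=> //; apply: krull_dim_infty.
left; have bnd m Q : prime_chain m Q -> (m <= N)%N.
  move=> Qm; rewrite leqNgt; apply/negP => /ltnW/prime_chainW/(_ Qm) QN.
  by apply: noN; exists Q.
have ex0 : exists n, `[< exists Q, prime_chain n Q >].
  by exists 0%N; apply/asboolP/prime_chain0.
have bnd' n : `[< exists Q, prime_chain n Q >] -> (n <= N)%N.
  by move=> /asboolP[Q]; apply: bnd.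
case: (ex_maxnP ex0 bnd') => n /asboolP chain_n max_n.
have max_n' m Q : prime_chain m Q -> (m <= n)%N.
  by move=> Qm; apply/max_n/asboolP; exists Q.
by exists n => //; apply: krull_dim_fin max_n'.
Qed.

End InfoAlgebraKrullDim.

(** * Prime ideals of the overflow semiring and their traces *)

Section OverflowIdeals.
Context {A : posInfoAlgType} {d : Order.disp_t} {L : orderType d}.
Local Notation S := (overflow A L).
Implicit Types (P : set A) (U : set L) (a b : A) (l : L).

Lemma ovf_addll a b : (inl a : S) + inl b = inl (a + b).
Proof. by []. Qed.

Lemma ovf_addlr a l : (inl a : S) + inr l = inr l.
Proof. by []. Qed.

Lemma ovf_addrr l l' : (inr l : S) + inr l' = inr (Order.max l l').
Proof. by rewrite /GRing.add /= /ovf_max /=; case: leP. Qed.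

Lemma ovf_mulll a b : (inl a : S) * inl b = inl (a * b).
Proof.
rewrite -[LHS]/(ovf_mul _ _) /ovf_mul; case: ifP => // /orP[] /eqP[->].
  by rewrite mul0r.
by rewrite mulr0.
Qed.

Lemma ovf_mullr a l : (inl a : S) * inr l = if a == 0 then 0 else inr l :> S.
Proof. by rewrite /GRing.mul /= /ovf_mul orbF. Qed.

Lemma ovf_mulrr l l' : (inr l : S) * inr l' = inr (Order.max l l').
Proof. by rewrite /GRing.mul /= /ovf_mul /= /ovf_max /=; case: leP. Qed.

Definition ovf_set P U : set S :=
  fun x => match x with inl a => P a | inr l => U l end.

Definition upset U := forall l l', U l -> (l <= l')%O -> U l'.

(** A nonzero [a] in [P] times [inr l] is [inr l], which forces all of [L] into the ideal: hence the
    last hypothesis. Primality is immediate once a factor lies in [L], since a nonzero product is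
    then one of its factors. *)
Lemma prime_ideal_ovf_set P U : is_prime_ideal P -> upset U ->
  U = setT \/ P `<=` [set 0] -> is_prime_ideal (ovf_set P U).
Proof.
move=> [Pideal PT Pprime] Uup UP.
have P0 := ideal0 _ _ Pideal; have P1 := (ideal_not1 _ _ Pideal).1 PT.
have Sideal : is_ideal (ovf_set P U).
  case: Pideal => _ PD PM; split; first by exists (inl 0).
    move=> [a|l] [b|l'].
    - by rewrite ovf_addll; apply: PD.
    - by rewrite ovf_addlr.
    - by rewrite addrC ovf_addlr.
    - by rewrite ovf_addrr => Ul _; apply: Uup Ul _; rewrite le_max lexx.
  move=> [a|l] [b|l'].
  - by rewrite ovf_mulll; apply: PM.
  - by rewrite ovf_mullr; case: ifP.
  - rewrite mulrC ovf_mullr; case: ifPn => // /eqP b0.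
    by case: UP => [->|UP] // /UP.
  - by rewrite ovf_mulrr => Ul; apply: Uup Ul _; rewrite le_max lexx orbT.
split=> //; first exact/(ideal_not1 _ _ Sideal).
move=> [a|l] [b|l'].
- by rewrite ovf_mulll; apply: Pprime.
- by rewrite ovf_mullr; case: eqP => [->|_] /=; [left|right].
- by rewrite mulrC ovf_mullr; case: eqP => [->|_] /=; [right|left].
- by rewrite ovf_mulrr /=; case: leP; [right|left].
Qed.

Lemma prime_ideal_inl (P : set S) : is_prime_ideal P ->
  is_prime_ideal (inl @^-1` P : set A).
Proof.
move=> [Pideal PT Pprime]; have P1 := (ideal_not1 _ _ Pideal).1 PT.
have P0 := ideal0 _ _ Pideal; case: Pideal => _ PD PM.
have Aideal : is_ideal (inl @^-1` P : set A).
  split=> [|a b Pa Pb|s a Pa]; first by exists 0.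
    by rewrite /preimage /= -ovf_addll; apply: PD.
  by rewrite /preimage /= -ovf_mulll; apply: PM.
split=> //; first exact/(ideal_not1 _ _ Aideal).
by move=> a b; rewrite /preimage /= -ovf_mulll; apply: Pprime.
Qed.

Lemma prime_chain_ovf N (U : nat -> set L) m Q :
    (forall i, (i < N)%N -> upset (U i) /\ U i <> setT) ->
    (forall i, (i.+1 < N)%N -> U i `<` U i.+1) -> prime_chain m Q ->
  prime_chain (N + m) (fun i =>
    if (i < N)%N then ovf_set [set 0] (U i) else ovf_set (Q (i - N)%N) setT).
Proof.
move=> Uup Ult [Qprime Qlt]; split=> i im.
  case: ltnP => [/Uup[Ui _]|_].
    by apply: prime_ideal_ovf_set => //; [apply: prime_ideal0|right].
  apply: prime_ideal_ovf_set => //; last by left.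
  by apply: Qprime; rewrite leq_subLR.
case: (ltngtP i.+1 N) => [SiN|NSi|SiN].
- have [UU nUU] := Ult _ SiN.
  by split=> [[a|l]//= /UU//|sub]; apply: nUU => l; apply: (sub (inr l)).
- rewrite subSn //.
  have [|QQ nQQ] := Qlt (i - N)%N; first by rewrite ltn_subLR.
  by split=> [[a|l]//= /QQ//|sub]; apply: nQQ => a; apply: (sub (inl a)).
(* At the junction of the two families, strictness comes from [U i <> setT] and inclusion from 0
   lying in [Q 0]. *)
- rewrite -SiN subnn; have [|_ Ui] := Uup i; first by rewrite -SiN.
  split=> [[a|l]//= ->|sub].
    by have [+ _ _] := Qprime 0%N isT; apply: ideal0.
  by apply: Ui; apply/seteqP; split=> // l _; apply: (sub (inr l)).
Qed.

(** The up-sets are the open rays above the elements of [B], from the greatest element down. Each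
    ray misses its own endpoint, which the next ray contains. *)
Lemma upset_chain (B : {fset L}) : exists U : nat -> set L,
  (forall i, (i < #|` B|)%N -> upset (U i) /\ U i <> setT) /\
  (forall i, (i.+1 < #|` B|)%N -> U i `<` U i.+1).
Proof.
have [->|[l0 _]] := fset_0Vmem B.
  by exists (fun=> set0); rewrite cardfs0.
pose s := sort <=%O B; have s_size : size s = #|` B| by rewrite size_sort.
have s_lt i j : (i < j)%N -> (j < #|` B|)%N -> (nth l0 s i < nth l0 s j)%O.
  move=> ij jB; rewrite lt_sorted_ltn_nth ?inE ?s_size ?(ltn_trans ij jB) //.
  by rewrite /s sort_lt_sorted fset_uniq.
exists (fun i => [set l | (nth l0 s (#|` B| - i.+1) < l)%O]); split=> i iB.
  split=> [l l' /= /lt_le_trans|UT]; first exact.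
  have : [set: L] (nth l0 s (#|` B| - i.+1)) by [].
  by rewrite -UT /= ltxx.
have lt_i : (nth l0 s (#|` B| - i.+2) < nth l0 s (#|` B| - i.+1))%O.
  by apply: s_lt; rewrite ?ltn_sub2l ?ltn_subrL //; apply: leq_trans iB.
split=> [l /=|/(_ _ lt_i)/=]; first exact: lt_trans.
by rewrite ltxx.
Qed.

Lemma prime_chain_fset (B : {fset L}) m :
  (exists Q : nat -> set A, prime_chain m Q) ->
  exists P : nat -> set S, prime_chain (#|` B| + m) P.
Proof.
have [U [Uup Ult]] := upset_chain B.
by case=> Q Qm; eexists; apply: prime_chain_ovf Uup Ult Qm.
Qed.

(** The trace on [A] may repeat along the chain, so [Q] keeps only its distinct values. The
    induction carries the top term [Q m] so that the next trace can be appended. *)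
Lemma prime_chain_trace n (P : nat -> set S) : finite_set [set: L] ->
  prime_chain n P ->
  exists m (Q : nat -> set A), [/\ prime_chain m Q, Q m = inl @^-1` P n &
    (n <= #|` fset_set (inr @^-1` P n : set L)| + m)%N].
Proof.
move=> finL; elim: n => [|n IHn] Pn.
  exists 0%N, (fun=> inl @^-1` P 0%N); split=> //; split=> // i _.
  by apply: prime_ideal_inl; case: Pn => + _; apply.
have [m [Q [Qm Qtop le_n]]] := IHn (prime_chainW _ _ _ _ (leqnSn n) Pn).
case: Pn => Pprime /(_ n (ltnSn n)) [PP nPP].
have fin (U : set L) : finite_set U by apply: sub_finite_set finL.
have le_card : (#|` fset_set (inr @^-1` P n : set L)| <=
    #|` fset_set (inr @^-1` P n.+1 : set L)|)%N.
  by apply: fsubset_leq_card; rewrite -fset_set_sub // => l; apply: PP.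
have [subA|nsubA] := pselect (inl @^-1` P n.+1 `<=` (inl @^-1` P n : set A)).
  exists m, Q; split=> //.
    by rewrite Qtop; apply/seteqP; split=> // a; apply: PP.
  (* Were the trace on [L] unchanged as well, [P n.+1] would lie in [P n]; so its cardinality pays
     for this step. *)
  apply: leq_ltn_trans le_n _; rewrite ltn_add2r; apply: fproper_ltn_card.
  rewrite fproperE; apply/andP; split; last apply/negP; rewrite -fset_set_sub //.
    by move=> l; apply: PP.
  by move=> subL; apply: nPP => -[a /subA|l /subL].
(* The trace on [A] grows: [m] pays for the step, and the count in [L] does not drop. *)
exists m.+1; eexists; split.
- apply: prime_chain_rcons Qm (prime_ideal_inl _ (Pprime n.+1 _)) _ => //.
  by rewrite Qtop; split=> // a; apply: PP.
- by rewrite /= ltnn.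
- by rewrite addnS ltnS (leq_trans le_n) // leq_add2r.
Qed.

End OverflowIdeals.

Theorem theorem4p15 (A : posInfoAlgType) (d : Order.disp_t) (L : orderType d)
    (L_wo : wochoice.well_order (<=%O : rel L)) :
  [/\ [set: L] = set0 -> (krull_dim A < +oo)%E ->
        krull_dim (overflow A L) = krull_dim A,
      infinite_set [set: L] \/ krull_dim A = +oo%E ->
        krull_dim (overflow A L) = +oo%E &
      finite_set [set: L] -> [set: L] !=set0 -> (krull_dim A < +oo)%E ->
        krull_dim (overflow A L) =
          ((#|` fset_set [set: L]|)%:Z%:E + krull_dim A)%E].
Proof.
(* Empty [L] is included, with cardinality 0, so the first and third clauses both follow. *)
have dim_fin : finite_set [set: L] -> (krull_dim A < +oo)%E ->
    krull_dim (overflow A L) = ((#|` fset_set [set: L]|)%:Z%:E + krull_dim A)%E.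
  move=> finL; have [[n -> [Qn max_n]] _|[-> _]] := krull_dimP A; last first.
    by rewrite ltxx.
  apply: krull_dim_fin; first exact: prime_chain_fset.
  move=> k P /(prime_chain_trace _ _ finL)[m [Q [/max_n le_mn _ le_k]]].
  apply: leq_trans le_k (leq_add _ le_mn).
  by apply: fsubset_leq_card; rewrite -fset_set_sub //; apply: sub_finite_set finL.
split=> [L0 dimA|[infL|dimA]|finL _ dimA]; last exact: dim_fin.
- have finL : finite_set [set: L] by rewrite L0; apply: finite_set0.
  by rewrite (dim_fin finL dimA) L0 fset_set0 cardfs0 add0e.
(* A finite [B] with at least [n] elements, over the one-term chain of [A], already gives length
   [n]. *)
- apply: krull_dim_infty => n; have [B _ nB] := infinite_set_fset n infL.
  have [P PB] := prime_chain_fset B 0 (prime_chain0 A).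
  by exists P; apply: prime_chainW PB; rewrite addn0.
- apply: krull_dim_infty => n.
  have [[m]|[_ /(_ n)]] := krull_dimP A; first by rewrite dimA.
  (* With [B] empty, a chain of [A] lifts with its length unchanged. *)
  by move/(prime_chain_fset (fset0 : {fset L})); rewrite cardfs0.
Qed.
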